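(* For every $1\le p<\infty$ and every measurable $\Omega\subset\Xi_{\mathrm{aff}}$ with $0<\mu_{\Xi_{\mathrm{aff}}}(\Omega)<\infty$, one has $$\sup_{\|f\|_{L^2(\mathbb{R})}=1}\|A_\rho f\|_{L^p(\Omega)}=\mu_{\Xi_{\mathrm{aff}}}(\Omega)^{1/p},$$ but the supremum is not attained.
   Context: $\Xi_{\mathrm{aff}}=\mathbb{R}\rtimes\mathbb{R}_+$ (with $\mathbb{R}_+=(0,\infty)$) is the affine group with product $(b,a)(b',a')=(b+ab',aa')$ and left Haar measure $d\mu_{\Xi_{\mathrm{aff}}}(b,a)=a^{-2}\,db\,da$. The affine wavelet representation on the complex Hilbert space $L^2(\mathbb{R})$ is $\rho(b,a)f(x)=a^{-1/2}f\left(\frac{x-b}{a}\right)$. The wavelet ambiguity transform is $A_\rho f(b,a)=\langle f,\rho(b,a)f\rangle_{L^2(\mathbb{R})}$, and $L^p(\Omega)$ is taken with respect to $\mu_{\Xi_{\mathrm{aff}}}$. *)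

(* Defs.v *)
From HB Require Import structures.
From mathcomp Require Import all_boot all_order all_algebra.
From mathcomp Require Import all_classical all_reals all_analysis.
From mathcomp Require Import measurable_realfun.
From mathcomp Require Export complex.

Set Implicit Arguments.
Unset Strict Implicit.
Unset Printing Implicit Defensive.

Import Order.TTheory GRing.Theory Num.Theory.
Import numFieldNormedType.Exports.

Local Open Scope classical_set_scope.
Local Open Scope ring_scope.

(* R * R with its Borel sigma-algebra. *)
Notation plane R := (measurableTypeR R * measurableTypeR R)%type.

Section AffineGroup.
Variable R : realType.

(* A point (b, a) of the open upper half-plane stands for y |-> a y + b. *)
Definition Xi_aff : set (plane R) := [set g | 0 < g.2].

(* Left Haar measure a^-2 db da, as a Borel measure on the plane vanishing
   outside Xi_aff. *)
Definition mu_aff (A : set (plane R)) : \bar R :=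
  (\int[lebesgue_measure \x lebesgue_measure]_(g in A `&` Xi_aff)
    ((g.2 : R) ^- 2)%:E)%E.

Lemma measurable_Xi_aff : measurable Xi_aff.
Proof.
have -> : Xi_aff = setT `*` `]0%R, +oo[%classic.
  by apply/seteqP; split=> -[b a]; rewrite /Xi_aff /= in_itv/= andbT => // -[].
by apply: measurableX => //; exact: measurable_itv.
Qed.

Lemma measurable_haar_density (D : set (plane R)) : measurable D -> D `<=` Xi_aff ->
  measurable_fun D (fun g : plane R => ((g.2 : R) ^- 2)%:E).
Proof.
move=> mD DX; apply/measurable_EFinP.
apply: (@eq_measurable_fun _ _ _ _ _ (fun g : plane R => (g.2 : R) `^ (- 2))).
  move=> g; rewrite inE => /DX /ltW g0.
  by rewrite powRN (powR_mulrn 2 g0).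
apply: measurable_funTS.
apply: (@measurableT_comp _ _ _ _ _ _ (fun a : R => a `^ (- 2))).
  exact: measurable_powR.
exact: measurable_snd.
Qed.

Lemma mu_aff0 : mu_aff set0 = 0%E.
Proof. by rewrite /mu_aff set0I integral_set0. Qed.

Lemma mu_aff_ge0 A : (0 <= mu_aff A)%E.
Proof. by apply: integral_ge0 => g _; rewrite lee_fin invr_ge0 sqr_ge0. Qed.

Lemma mu_aff_semi_sigma_additive : semi_sigma_additive mu_aff.
Proof.
move=> F mF tF _; rewrite /mu_aff setI_bigcupl.
have mFX i : measurable (F i `&` Xi_aff).
  by apply: measurableI => //; exact: measurable_Xi_aff.
rewrite ge0_integral_bigcup//=.
- apply: is_cvg_ereal_nneg_natsum_cond => n _ _.
  by apply: integral_ge0 => g _; rewrite lee_fin invr_ge0 sqr_ge0.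
- apply: measurable_haar_density; first exact: bigcup_measurable.
  by move=> g [i _ []].
- by move=> g _; rewrite lee_fin invr_ge0 sqr_ge0.
- move/trivIsetP: tF => tF; apply/trivIsetP => i j _ _ ij.
  by rewrite setIACA tF// set0I.
Qed.

HB.instance Definition _ := isMeasure.Build _ _ _ mu_aff
  mu_aff0 mu_aff_ge0 mu_aff_semi_sigma_additive.

End AffineGroup.

Section WaveletRepresentation.
Variable R : realType.
Local Open Scope complex_scope.
Implicit Types f g : R -> R[i].

Definition cmodulus (z : R[i]) : R := ComplexField.Normc.normc z.

Definition cintegral (h : R -> R[i]) : R[i] :=
  (\int[@lebesgue_measure R]_x complex.Re (h x))%R
    +i* (\int[@lebesgue_measure R]_x complex.Im (h x))%R.

Definition L2norm f : \bar R := 'N[@lebesgue_measure R]_2%:E[EFin \o (cmodulus \o f)].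

(* Elements of the complex space L^2(R) are given by Borel representatives;
   all the notions below depend only on their almost-everywhere classes. *)
Definition in_L2 f : Prop :=
  [/\ measurable_fun setT (fun x => complex.Re (f x)),
      measurable_fun setT (fun x => complex.Im (f x)) &
      (L2norm f < +oo)%E].

Definition L2inner f g : R[i] := cintegral (fun x => f x * conjc (g x)).

Definition rho_aff (xi : plane R) f : R -> R[i] :=
  fun x => (xi.2 `^ (- 2^-1))%:C * f ((x - xi.1) / xi.2).

Definition ambiguity f : plane R -> R[i] := fun xi => L2inner f (rho_aff xi f).

(* [\_ Omega] extends by zero (the point of [\bar R]) outside [Omega]. *)
Definition LpOn_norm (p : R) (Omega : set (plane R)) (F : plane R -> R[i]) : \bar R :=
  'N[@mu_aff R]_p%:E[(EFin \o (cmodulus \o F)) \_ Omega].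

Definition L2_unit_sphere : set (R -> R[i]) := [set f | in_L2 f /\ L2norm f = 1%E].

End WaveletRepresentation.

(* Main.v *)
Require Import Defs.
From mathcomp Require Import all_boot all_order all_algebra.
From mathcomp Require Import all_classical all_reals all_analysis.
From mathcomp Require Import ring lra measurable_realfun.

Import Order.TTheory GRing.Theory Num.Theory.
Import numFieldNormedType.Exports.

Local Open Scope classical_set_scope.
Local Open Scope ring_scope.

(* Write F = |f| and G = a^(-1/2) F((x - b) / a), so that |A_rho f(b, a)| is at
   most the overlap of F and G, and 2 overlap + ||F - G||^2 = 2. Hence
   |A_rho f| <= 1, which gives the upper bound.

   The profiles (s x)^(-1/2) on [1, e^s] are unit vectors whose overlap with
   each of their translates and dilates is at least 1 - K(b, a) / s; letting s
   tend to infinity, dominated convergence shows that the bound is the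
   supremum.

   If f attained it, the overlap would be 1 at almost every point of Omega,
   hence at some (b, a) with a <> 1. There F = G almost everywhere, i.e. the
   density F^2 is invariant under x |-> a x + b. This map has a fixed point c,
   and by invariance all balls centred at c have the same mass, which would be
   both the total mass 1 (large radius) and 0 (small radius). *)

(** * Comparison of integrals and affine substitution on the line *)

(** The integral of a nonnegative function is a supremum over the simple functions below it, and
    their set grows with the function. This form lets powers of the modulus of [ambiguity f] be
    compared directly, without a separate measurability proof. *)
Lemma ge0_le_integral_nonmeasurable {d} {T : measurableType d} {R : realType}
    (mu : {measure set T -> \bar R}) (D : set T) (f g : T -> \bar R) :
  (forall x, D x -> (0 <= f x)%E) -> (forall x, D x -> (f x <= g x)%E) ->
  (\int[mu]_(x in D) f x <= \int[mu]_(x in D) g x)%E.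
Proof.
move=> f0 fg; rewrite !(integral_mkcond D).
have fgD x : ((f \_ D) x <= (g \_ D) x)%E.
  by rewrite !patchE; case: ifPn => //; rewrite inE; exact: fg.
have f0D x : (0 <= (f \_ D) x)%E.
  by rewrite patchE; case: ifPn => //; rewrite inE; exact: f0.
rewrite !ge0_integralTE//; last by move=> x; exact: le_trans (fgD x).
apply: le_ereal_sup => _ [h hf <-]; exists h => // x.
exact: le_trans (hf x) (fgD x).
Qed.

Lemma measurable_affine {R : realType} (a b : R) :
  measurable_fun [set: R] (fun x => (x - b) / a).
Proof. by apply: measurable_funM => //; exact: measurable_funB. Qed.

(** Divided by [a], the pushforward gives every half-open interval its length, so uniqueness of
    Lebesgue measure applies. *)
Lemma pushforward_lebesgue_affine {R : realType} (a b : R)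
    (A : set (measurableTypeR R)) : 0 < a -> measurable A ->
  pushforward (@lebesgue_measure R) (fun x => (x - b) / a : measurableTypeR R) A
  = (a%:E * lebesgue_measure A)%E.
Proof.
move=> a0 mA; have ai0 : 0 <= a^-1 by rewrite invr_ge0 ltW.
suff -> : lebesgue_measure A = mscale (NngNum ai0)
    (pushforward (@lebesgue_measure R) (fun x => (x - b) / a : measurableTypeR R)) A.
- exact: measurable_affine.
- by move=> mphi; rewrite /mscale /= muleA -EFinM divff ?gt_eqF// mul1e.
move=> mphi; apply: lebesgue_measure_unique => // _ [[x y] _ <-] /=; rewrite /mscale /= /pushforward.
rewrite (_ : _ @^-1` _ = `]a * x + b, a * y + b]%classic); last first.
  apply/seteqP; split => z /=; rewrite !in_itv/= ltr_pdivlMr// ler_pdivrMr//;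
    by move=> /andP[? ?]; apply/andP; split; lra.
rewrite !lebesgue_measure_itv/= !lte_fin ltrD2r ltr_pM2l//.
case: ifPn => xy; last by rewrite mule0.
rewrite -!EFinB -EFinM; congr EFin; field.
by rewrite gt_eqF.
Qed.

Lemma ge0_integral_affine {R : realType} (a b : R) (h : R -> \bar R) :
  0 < a -> measurable_fun [set: R] h -> (forall x, (0 <= h x)%E) ->
  (\int[lebesgue_measure]_x h ((x - b) / a)%R
   = a%:E * \int[lebesgue_measure]_x h x)%E.
Proof.
move=> a0 mh h0; have an : 0 <= a by exact: ltW.
rewrite -(ge0_integral_mscale lebesgue_measure measurableT (NngNum an))//.
pose phi (x : measurableTypeR R) : measurableTypeR R := (x - b) / a.
have mphi : measurable_fun setT phi by exact: measurable_affine.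
transitivity (\int[pushforward lebesgue_measure phi]_x h x)%E.
  by rewrite (ge0_integral_pushforward mphi)// preimage_setT.
by apply: eq_measure_integral => A mA _; exact: pushforward_lebesgue_affine.
Qed.

Lemma measurable_fun_inv {R : realType} :
  measurable_fun [set: R] (@GRing.inv R).
Proof.
(* [x / x ^ 2] also covers [x = 0], where both sides are [0]. *)
rewrite (_ : @GRing.inv R = fun x => x * (x ^+ 2) `^ (-1)).
  apply: measurable_funM => //.
  by apply: (measurableT_comp (measurable_powR _)); exact: measurable_funX.
apply/funext => x; have [->|x0] := eqVneq x 0; first by rewrite invr0 mul0r.
by rewrite powR_inv1 ?sqr_ge0// expr2 invfM mulrA divff// mul1r.
Qed.

(** * Overlap of a nonnegative profile with its translates and dilates *)

Section Overlap.
Context {R : realType}.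
Implicit Types (F : R -> R) (xi : plane R).
Local Notation leb := (@lebesgue_measure R).

(** The effect of [rho_aff xi] on moduli. *)
Definition dilate xi F : R -> R :=
  fun x => xi.2 `^ (- 2^-1) * F ((x - xi.1) / xi.2).

Definition overlap F xi : \bar R := (\int[leb]_x (F x * dilate xi F x)%:E)%E.

Lemma measurable_dilate xi F :
  measurable_fun setT F -> measurable_fun setT (dilate xi F).
Proof.
move=> mF; apply: measurable_funM => //.
exact: measurableT_comp mF (measurable_affine _ _).
Qed.

Lemma dilate_ge0 xi F x : (forall x, 0 <= F x) -> 0 <= dilate xi F x.
Proof. by move=> F0; rewrite mulr_ge0// powR_ge0. Qed.

Lemma sqr_powR_half (a : R) : 0 < a -> (a `^ (- 2^-1)) ^+ 2 = a^-1.
Proof.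
move=> a0; rewrite -powR_mulrn ?powR_ge0// -powRrM mulNr mulVf//.
by rewrite powR_inv1// ltW.
Qed.

(** The Jacobian [xi.2] of the substitution cancels the square of the normalizing factor. *)
Lemma integral_sqr_dilate xi F : 0 < xi.2 -> measurable_fun setT F ->
  (\int[leb]_x (dilate xi F x ^+ 2)%:E = \int[leb]_x (F x ^+ 2)%:E)%E.
Proof.
move=> a0 mF.
have mF2 : measurable_fun setT (fun x => (F x ^+ 2)%:E).
  by apply/measurable_EFinP; exact: measurable_funX.
under eq_integral do rewrite exprMn sqr_powR_half// EFinM.
rewrite ge0_integralZl//=; last 3 first.
- exact: (measurableT_comp mF2 (measurable_affine _ _)).
- by move=> x _; rewrite lee_fin sqr_ge0.
- by rewrite lee_fin invr_ge0 ltW.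
rewrite (ge0_integral_affine _ _ (fun x => (F x ^+ 2)%:E))//; last first.
  by move=> x; rewrite lee_fin sqr_ge0.
by rewrite muleA -EFinM mulVf ?gt_eqF// mul1e.
Qed.

Lemma overlap_ge0 F xi : (forall x, 0 <= F x) -> (0 <= overlap F xi)%E.
Proof.
by move=> F0; apply: integral_ge0 => x _; rewrite lee_fin mulr_ge0// dilate_ge0.
Qed.

(** Expand the square of F - G, where the dilate G has the same norm as F. Stating the result as a
    sum avoids subtraction of extended reals. *)
Lemma overlap_defect F xi : 0 < xi.2 -> measurable_fun setT F ->
  (forall x, 0 <= F x) -> (\int[leb]_x (F x ^+ 2)%:E = 1)%E ->
  (2%:E * overlap F xi + \int[leb]_x ((F x - dilate xi F x) ^+ 2)%:E = 2%:E)%E.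
Proof.
move=> a0 mF F0 F1.
have mG := measurable_dilate xi F mF.
rewrite /overlap -ge0_integralZl//=; last 2 first.
- by apply/measurable_EFinP; exact: measurable_funM.
- by move=> x _; rewrite lee_fin mulr_ge0// dilate_ge0.
rewrite -ge0_integralD//=; last 4 first.
- by move=> x _; rewrite lee_fin mulr_ge0// mulr_ge0// dilate_ge0.
- by apply/measurable_EFinP; apply: measurable_funM => //; exact: measurable_funM.
- by move=> x _; rewrite lee_fin sqr_ge0.
- by apply/measurable_EFinP; apply: measurable_funX; exact: measurable_funB.
under eq_integral => x _.
  rewrite -EFinM -EFinD.
  rewrite (_ : _ + _ = F x ^+ 2 + dilate xi F x ^+ 2); last by ring.
  rewrite EFinD; over.
rewrite ge0_integralD//=; last 4 first.
- by move=> x _; rewrite lee_fin sqr_ge0.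
- by apply/measurable_EFinP; exact: measurable_funX.
- by move=> x _; rewrite lee_fin sqr_ge0.
- by apply/measurable_EFinP; exact: measurable_funX.
by rewrite integral_sqr_dilate// F1 -EFinD.
Qed.

Lemma overlap_le1 F xi : 0 < xi.2 -> measurable_fun setT F ->
  (forall x, 0 <= F x) -> (\int[leb]_x (F x ^+ 2)%:E = 1)%E ->
  (overlap F xi <= 1)%E.
Proof.
move=> a0 mF F0 F1.
have := overlap_defect F xi a0 mF F0 F1.
have : (0 <= \int[leb]_x ((F x - dilate xi F x) ^+ 2)%:E)%E.
  by apply: integral_ge0 => x _; rewrite lee_fin sqr_ge0.
have := overlap_ge0 F xi F0.
(* Both terms are nonnegative and add up to 2, which excludes infinite values. *)
move: (overlap F xi) (integral _ _ _) => [u| |] [v| |]//=.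
- by rewrite !lee_fin -EFinM -EFinD => u0 v0 [?]; lra.
- by rewrite gt0_muley ?lte_fin.
- by rewrite gt0_muley ?lte_fin.
Qed.

(** The integrand is jointly measurable in [xi] and [x], so Tonelli's theorem gives measurability of
    the partial integral. *)
Lemma measurable_overlap F : measurable_fun setT F -> (forall x, 0 <= F x) ->
  measurable_fun [set: plane R] (overlap F).
Proof.
move=> mF F0.
pose k (z : plane R * R) : \bar R := (F z.2 * dilate z.1 F z.2)%:E.
apply: (measurable_fun_fubini_tonelli_F (m2 := leb) k); last first.
  by move=> z; rewrite lee_fin mulr_ge0// dilate_ge0.
apply/measurable_EFinP; apply: measurable_funM.
  exact: measurableT_comp mF measurable_snd.
have mb : measurable_fun setT (fun z : plane R * measurableTypeR R => z.1.1 : R).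
  exact: measurableT_comp measurable_fst measurable_fst.
have ma : measurable_fun setT (fun z : plane R * measurableTypeR R => z.1.2 : R).
  exact: measurableT_comp measurable_snd measurable_fst.
apply: measurable_funM.
  exact: (measurableT_comp (measurable_powR _) ma).
apply: (measurableT_comp mF); apply: measurable_funM.
  exact: measurable_funB measurable_snd mb.
exact: measurableT_comp measurable_fun_inv ma.
Qed.

End Overlap.

(** * Complex moduli and the passage from the ambiguity transform to the overlap *)

Section Wavelet.
Context {R : realType}.
Implicit Types (F : R -> R) (f h : R -> R[i]) (xi : plane R).
Local Notation leb := (@lebesgue_measure R).
Local Open Scope complex_scope.

Lemma cmodulusE (z : R[i]) :
  cmodulus z = Num.sqrt (complex.Re z ^+ 2 + complex.Im z ^+ 2).
Proof. by case: z. Qed.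

Lemma cmodulus_ge0 (z : R[i]) : 0 <= cmodulus z.
Proof. by rewrite cmodulusE sqrtr_ge0. Qed.

Lemma cmodulusM (z w : R[i]) : cmodulus (z * w) = cmodulus z * cmodulus w.
Proof. exact: ComplexField.Normc.normcM. Qed.

Lemma cmodulusJ (z : R[i]) : cmodulus (conjc z) = cmodulus z.
Proof. by case: z => a b; rewrite !cmodulusE /= sqrrN. Qed.

Lemma cmodulus_real (x : R) : 0 <= x -> cmodulus x%:C = x.
Proof. by move=> x0; rewrite cmodulusE /= expr0n /= addr0 sqrtr_sqr ger0_norm. Qed.

Lemma norm_Re_le_cmodulus (z : R[i]) : `|complex.Re z| <= cmodulus z.
Proof.
by rewrite cmodulusE -sqrtr_sqr ler_wsqrtr// lerDl sqr_ge0.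
Qed.

Lemma norm_Im_le_cmodulus (z : R[i]) : `|complex.Im z| <= cmodulus z.
Proof.
by rewrite cmodulusE -sqrtr_sqr ler_wsqrtr// lerDr sqr_ge0.
Qed.

(** The left side is the real part of [conjc z * w]. *)
Lemma Re_Im_le_cmodulus (z w : R[i]) :
  complex.Re z * complex.Re w + complex.Im z * complex.Im w
  <= cmodulus z * cmodulus w.
Proof.
rewrite -cmodulusJ -cmodulusM.
apply: le_trans (norm_Re_le_cmodulus _); apply: le_trans (ler_norm _).
by case: z w => [a b] [c d] /=; lra.
Qed.

Lemma measurable_cmodulus h :
  measurable_fun setT (fun x => complex.Re (h x)) ->
  measurable_fun setT (fun x => complex.Im (h x)) ->
  measurable_fun setT (@cmodulus R \o h).
Proof.
move=> mr mi; apply: (eq_measurable_fun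
    (fun x => (complex.Re (h x) ^+ 2 + complex.Im (h x) ^+ 2) `^ 2^-1)).
  by move=> x _; rewrite /= cmodulusE powR12_sqrt// addr_ge0 ?sqr_ge0.
apply: (measurableT_comp (measurable_powR _)).
by apply: measurable_funD; exact: measurable_funX.
Qed.

(** With z the integral of h, |z|^2 is the integral of Re z Re h + Im z Im h, which is at most |z|
    times the integral of |h|. It remains to divide by |z|, the case z = 0 being trivial. *)
Lemma cmodulus_cintegral_le h :
  measurable_fun setT (fun x => complex.Re (h x)) ->
  measurable_fun setT (fun x => complex.Im (h x)) ->
  (\int[leb]_x (cmodulus (h x))%:E < +oo)%E ->
  ((cmodulus (cintegral h))%:E <= \int[leb]_x (cmodulus (h x))%:E)%E.
Proof.
move=> mr mi hoo; set z := cintegral h.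
have mm := measurable_cmodulus h mr mi.
have ih : leb.-integrable setT (EFin \o (@cmodulus R \o h)).
  apply/integrableP; split; first exact/measurable_EFinP.
  apply: le_lt_trans hoo; apply: ge0_le_integral => //=.
  - by do 2 apply: measurableT_comp => //.
  - exact/measurable_EFinP.
  - by move=> x _; rewrite ger0_norm// cmodulus_ge0.
have ir : leb.-integrable setT (EFin \o (fun x => complex.Re (h x))).
  apply: le_integrable ih => //; first exact/measurable_EFinP.
  move=> x _; rewrite /= lee_fin (le_trans (norm_Re_le_cmodulus _))//.
  exact: ler_norm.
have ii : leb.-integrable setT (EFin \o (fun x => complex.Im (h x))).
  apply: le_integrable ih => //; first exact/measurable_EFinP.
  move=> x _; rewrite /= lee_fin (le_trans (norm_Im_le_cmodulus _))//.
  exact: ler_norm.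
have iZ k (g : R -> R) : leb.-integrable setT (EFin \o g) ->
    leb.-integrable setT (EFin \o (fun x => k * g x)).
  by move=> ig; exact: (integrableZl measurableT k ig).
have hfin : (\int[leb]_x (cmodulus (h x))%:E)%E \is a fin_num.
  rewrite ge0_fin_numE//; apply: integral_ge0 => x _.
  by rewrite lee_fin cmodulus_ge0.
rewrite -(fineK hfin) lee_fin.
have [->|z0] := eqVneq (cmodulus z) 0.
  by apply: fine_ge0; apply: integral_ge0 => x _; rewrite lee_fin cmodulus_ge0.
have zgt0 : 0 < cmodulus z by rewrite lt_neqAle eq_sym z0 cmodulus_ge0.
rewrite -(ler_pM2l zgt0).
rewrite [leLHS](_ : _ = (\int[leb]_x (complex.Re z * complex.Re (h x)
    + complex.Im z * complex.Im (h x)))); last first.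
  rewrite RintegralD//; [|exact: iZ..].
  by rewrite !RintegralZl// -!expr2 cmodulusE sqr_sqrtr ?addr_ge0 ?sqr_ge0//.
rewrite -[leRHS](RintegralZl (cmodulus z) measurableT ih).
apply: le_Rintegral => //.
- exact: (integrableD measurableT (iZ _ _ ir) (iZ _ _ ii)).
- exact: iZ.
- by move=> x _; exact: Re_Im_le_cmodulus.
Qed.

Lemma measurable_cmodulus_L2 f : in_L2 f -> measurable_fun setT (@cmodulus R \o f).
Proof. by case=> mr mi _; exact: measurable_cmodulus. Qed.

Lemma integral_sqr_cmodulus f : L2norm f = 1%E ->
  (\int[leb]_x (cmodulus (f x) ^+ 2)%:E = 1)%E.
Proof.
move=> f1; have := @poweR_Lnorm _ _ _ leb (EFin \o (@cmodulus R \o f)) 2.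
rewrite -/(L2norm f) f1 poweR1r => E; apply/esym; rewrite [LHS]E//.
apply: eq_integral => x _ /=.
by rewrite ger0_norm ?cmodulus_ge0// ?poweR_EFin powR_mulrn// cmodulus_ge0.
Qed.

Lemma cmodulus_rho_aff xi f x :
  cmodulus (rho_aff xi f x) = dilate xi (@cmodulus R \o f) x.
Proof. by rewrite cmodulusM cmodulus_real// powR_ge0. Qed.

(** Triangle inequality for the integral: the modulus of the integrand of [ambiguity f xi] is the
    integrand of the overlap of |f|. *)
Lemma ambiguity_le_overlap f xi : L2_unit_sphere f -> 0 < xi.2 ->
  ((cmodulus (ambiguity f xi))%:E <= overlap (@cmodulus R \o f) xi)%E.
Proof.
move=> [Lf f1] a0; have mF := measurable_cmodulus_L2 f Lf.
have F0 x : 0 <= (@cmodulus R \o f) x by exact: cmodulus_ge0.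
have [mr mi _] := Lf.
have mr' := measurableT_comp mr (measurable_affine xi.2 xi.1).
have mi' := measurableT_comp mi (measurable_affine xi.2 xi.1).
have overlapE : overlap (@cmodulus R \o f) xi =
    (\int[leb]_x (cmodulus (f x * conjc (rho_aff xi f x)))%:E)%E.
  by apply: eq_integral => x _; rewrite cmodulusM cmodulusJ cmodulus_rho_aff.
rewrite overlapE; apply: cmodulus_cintegral_le.
(* The real part, and below it the imaginary part, is expanded into products of real measurable
   functions. *)
- apply: (eq_measurable_fun (fun x => xi.2 `^ (- 2^-1) *
    (complex.Re (f x) * complex.Re (f ((x - xi.1) / xi.2)) +
     complex.Im (f x) * complex.Im (f ((x - xi.1) / xi.2))))).
    move=> x _; rewrite /rho_aff.
    move: (f x) (f ((x - xi.1) / xi.2)) (_ `^ _) => [u v] [s t] r /=; lra.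
  by apply: measurable_funM => //; apply: measurable_funD; exact: measurable_funM.
- apply: (eq_measurable_fun (fun x => xi.2 `^ (- 2^-1) *
    (complex.Im (f x) * complex.Re (f ((x - xi.1) / xi.2)) -
     complex.Re (f x) * complex.Im (f ((x - xi.1) / xi.2))))).
    move=> x _; rewrite /rho_aff.
    move: (f x) (f ((x - xi.1) / xi.2)) (_ `^ _) => [u v] [s t] r /=; lra.
  by apply: measurable_funM => //; apply: measurable_funB; exact: measurable_funM.
- rewrite -overlapE; apply: le_lt_trans (ltry 1).
  by apply: overlap_le1 => //; exact: integral_sqr_cmodulus.
Qed.

Lemma real_L2_unit_sphere F : measurable_fun setT F -> (forall x, 0 <= F x) ->
  (\int[leb]_x (F x ^+ 2)%:E = 1)%E ->
  L2_unit_sphere (fun x => (F x)%:C).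
Proof.
move=> mF F0 F1; have f1 : L2norm (fun x => (F x)%:C) = 1%E.
  rewrite /L2norm (_ : cmodulus (R:=R) \o _ = F); last first.
    by apply/funext => x; rewrite [LHS]cmodulus_real.
  rewrite unlock /=.
  under eq_integral => x _ do rewrite ger0_norm// powR_mulrn//.
  by rewrite F1 poweR1r.
by split=> //; split=> //; rewrite f1 ltry.
Qed.

(** For a nonnegative real function the integrand has no phase, so the bound [ambiguity_le_overlap]
    becomes an equality. *)
Lemma cmodulus_ambiguity_real F xi : 0 < xi.2 ->
  measurable_fun setT F -> (forall x, 0 <= F x) ->
  (\int[leb]_x (F x ^+ 2)%:E = 1)%E ->
  (cmodulus (ambiguity (fun x => (F x)%:C) xi))%:E = overlap F xi.
Proof.
move=> a0 mF F0 F1.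
have ofin : overlap F xi \is a fin_num.
  rewrite ge0_fin_numE ?overlap_ge0//; apply: le_lt_trans (ltry 1).
  exact: overlap_le1.
rewrite /ambiguity /L2inner /cintegral.
rewrite [X in _ +i* X](_ : _ = 0); last first.
  rewrite /Rintegral integral0_eq// => x _.
  by congr EFin; rewrite /rho_aff /=; ring.
rewrite [X in X +i* _](_ : _ = fine (overlap F xi)); last first.
  congr fine; apply: eq_integral => x _; congr EFin.
  by rewrite /rho_aff /dilate /=; ring.
by rewrite -[_ +i* 0]/(_%:C) cmodulus_real ?fine_ge0 ?overlap_ge0// fineK.
Qed.

Lemma poweR_LpOn_norm (p : R) (Omega : set (plane R)) (A : plane R -> R[i]) :
  0 < p -> ((LpOn_norm p Omega A) `^ p
            = \int[@mu_aff R]_(xi in Omega) ((cmodulus (A xi)) `^ p)%:E)%E.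
Proof.
move=> p0; rewrite /LpOn_norm poweR_Lnorm ?gt_eqF// [RHS]integral_mkcond.
apply: eq_integral => xi _; rewrite !patchE; case: ifPn => _ /=.
  by rewrite ger0_norm ?cmodulus_ge0// ?poweR_EFin.
(* Outside [Omega] the zero extension contributes 0 to the power [p], which is 0 because [p] is
   positive. *)
by rewrite normr0 ?poweR_EFin powR0// gt_eqF.
Qed.

End Wavelet.

(** * Integrable densities invariant under a dilation about a fixed point *)

Lemma exists_expr_lt {R : realType} (q e : R) :
  0 < q < 1 -> 0 < e -> exists n, q ^+ n < e.
Proof.
move=> /andP[q0 q1] e0; have qn : `|q| < 1 by rewrite gtr0_norm.
have /cvgrPdist_lt/(_ e e0)[N _ HN] := cvg_expr qn.
exists N; have /= := HN N (leqnn N).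
by rewrite sub0r normrN normrX gtr0_norm.
Qed.

Section DilationInvariantDensity.
Context {R : realType}.
Local Notation leb := (@lebesgue_measure R).
Variables (a b : R) (h : R -> \bar R).
Hypotheses (a0 : 0 < a) (a1 : a != 1).
Hypotheses (mh : measurable_fun setT h) (h0 : forall x, (0 <= h x)%E).
Hypothesis hinv : ae_eq leb setT h (fun x => (a^-1%:E * h ((x - b) / a)%R)%E).

(* The point fixed by the affine map [x |-> a x + b]. *)
Let c := b / (1 - a).

Let dist (x : R) : R := `|x - c|.

Let dist_ge0 x : 0 <= dist x.
Proof. exact: normr_ge0. Qed.

Let mdist : measurable_fun [set: R] dist.
Proof. by apply: measurableT_comp => //; exact: measurable_funB. Qed.

Let mpreim (A : set R) : measurable A -> measurable [set x : R | A (dist x)].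
Proof. by move=> mA; rewrite -[X in measurable X]setTI; exact: mdist. Qed.

Let mscale_set (z : R) (A : set R) :
  measurable A -> measurable [set t : R | A (z * t)].
Proof.
have mz : measurable_fun [set: R] (fun t => z * t) by exact: measurable_funM.
by move=> mA; rewrite -[X in measurable X]setTI; exact: mz.
Qed.

(** Sets are described through the distance to [c], so that the affine map acts on [A] simply as
    multiplication by [a]. *)
Let mass (A : set R) : \bar R := (\int[leb]_(x in [set x : R | A (dist x)]) h x)%E.

(** Since c = a c + b, the affine map multiplies distances to [c] by [a]. *)
Let dist_dilate x : dist x = a * dist ((x - b) / a).
Proof.
rewrite /dist -[X in X * _](gtr0_norm a0) -normrM; congr `|_|.
have na : 1 - a != 0 by rewrite subr_eq0 eq_sym.
rewrite /c; field.
by rewrite na gt_eqF.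
Qed.

(** Replace [h] by its transformed copy and substitute (x - b) / a: the Jacobian cancels the factor
    [a^-1]. *)
Let mass_dilate (A B : set R) : measurable A -> measurable B ->
  (forall t, A (a * t) <-> B t) -> mass A = mass B.
Proof.
move=> mA mB AB.
have mSA := mpreim _ mA; have mSB := mpreim _ mB.
have mhB : measurable_fun setT (h \_ [set x : R | B (dist x)]).
  by apply/(measurable_restrictT _ _).1 => //; exact: measurable_funTS.
have hB0 x : (0 <= (h \_ [set x : R | B (dist x)]) x)%E.
  by rewrite patchE; case: ifP.
transitivity (\int[leb]_(x in [set x : R | A (dist x)]) (a^-1%:E * h ((x - b) / a)%R))%E.
  apply: ge0_ae_eq_integral => //; last exact: ae_eq_subset hinv.
  - exact: measurable_funTS.
  - apply: measurable_funTS; apply: measurable_funeM.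
    exact: measurableT_comp mh (measurable_affine _ _).
  - by move=> x _; rewrite mule_ge0// lee_fin invr_ge0 ltW.
rewrite /mass integral_mkcond.
transitivity (\int[leb]_x (a^-1%:E * (h \_ [set x : R | B (dist x)]) ((x - b) / a)%R))%E.
  apply: eq_integral => x _; rewrite !patchE.
  have -> : (x \in [set x : R | A (dist x)]) = ((x - b) / a \in [set x : R | B (dist x)]).
    by apply/idP/idP; rewrite !inE /= (dist_dilate x) => /AB.
  by case: ifPn => //; rewrite mule0.
rewrite ge0_integralZl//=; last 2 first.
- exact: (measurableT_comp mhB (measurable_affine _ _)).
- by rewrite lee_fin invr_ge0 ltW.
rewrite (ge0_integral_affine a b (h \_ [set x : R | B (dist x)]))//.
by rewrite muleA -EFinM mulVf ?gt_eqF// mul1e -integral_mkcond.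
Qed.

Let mass_iter (z : R) (A : set R) : z = a \/ z = a^-1 -> measurable A ->
  forall n, mass [set t | A (z ^+ n * t)] = mass A.
Proof.
move=> za mA; have mz n := mscale_set (z ^+ n) A mA.
elim=> [|n IH]; first by congr mass; apply/funext => t; rewrite /= expr0 mul1r.
rewrite -IH; case: za => za.
- apply/esym; apply: mass_dilate => // t /=.
  by rewrite exprSr -mulrA -za.
- apply: mass_dilate => // t /=.
  by rewrite exprSr za mulrA mulfVK ?gt_eqF.
Qed.

(** The rescaled sets increase to [D] and all have the mass of [A]; continuity from below then
    equates this constant with the mass of [D]. *)
Let mass_cvg (q : R) (A : set R) (D : set R) :
  measurable A ->
  nondecreasing_seq (fun n => [set t | A (q ^+ n * t)]) ->
  \bigcup_n [set x : R | A (q ^+ n * dist x)] = D ->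
  q = a \/ q = a^-1 ->
  mass A = (\int[leb]_(x in D) h x)%E.
Proof.
move=> mA nd <- qa.
have mAn n : measurable [set x : R | A (q ^+ n * dist x)].
  exact: (mpreim _ (mscale_set (q ^+ n) A mA)).
rewrite -(cvg_lim _ (ge0_nondecreasing_set_cvg_integral (mu := leb) _ mAn
  (fun n => measurable_funTS mh) (fun n x _ => h0 x)))//; last first.
  by move=> m n mn; apply/subsetPset => x; move/subsetPset: (nd m n mn); apply.
by under eq_fun do rewrite -/(mass [set t | A (q ^+ _ * t)]) mass_iter//; rewrite lim_cst.
Qed.

(** Enlarging the unit ball about [c] exhausts the line, while shrinking it makes its complement
    exhaust the line without [c]. Hence ball and complement each carry the total mass m, so m + m =
    m, and m = 0 by finiteness. *)
Lemma dilation_invariant_density_eq0 :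
  (\int[leb]_x h x < +oo)%E -> (\int[leb]_x h x = 0)%E.
Proof.
move=> hoo.
have [q q01 qa] : exists2 q, 0 < q < 1 & q = a \/ q = a^-1.
  move: a1; rewrite neq_lt => /orP[a_lt1|a_gt1].
    by exists a; [rewrite a0|left].
  by exists a^-1; [rewrite invr_gt0 a0 invf_lt1|right].
have qVa : q^-1 = a \/ q^-1 = a^-1.
  by case: qa => ->; [right|left; rewrite invrK].
have /andP[q0 q1] := q01.
have inner : mass `]-oo, 1]%classic = (\int[leb]_x h x)%E.
  apply: (mass_cvg q) => //.
  - move=> m n mn; apply/subsetPset => t; rewrite /= !in_itv/= => qt.
    have [t0|t0] := leP t 0.
      by rewrite (le_trans _ ler01)// mulr_ge0_le0// exprn_ge0// ltW.
    by apply: le_trans qt; rewrite ler_pM2r// ler_wiXn2l// ltW.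
  - apply/seteqP; split => // x _.
    (* The added 1 keeps the threshold positive and defined even at x = c, and still forces q^n
       times the distance to be at most 1. *)
    have [|n qn] := exists_expr_lt q (dist x + 1)^-1 q01.
      by rewrite invr_gt0 ltr_wpDl// dist_ge0.
    exists n => //=; rewrite in_itv/=.
    rewrite (le_trans (_ : _ <= (dist x + 1)^-1 * (dist x + 1)))//.
      by rewrite ler_pM ?exprn_ge0 ?dist_ge0 ?(ltW q0) ?(ltW qn) ?lerDl.
    by rewrite mulVf// gt_eqF// ltr_wpDl// dist_ge0.
have outer : mass `]1, +oo[%classic = (\int[leb]_x h x)%E.
  have mDc : measurable (setT `\ c) by exact: measurableD.
  (* The centre [c] stays at distance 0 under every rescaling and is never reached; as a null set it
     can be removed. *)
  rewrite -(integral_setD1 (r := c))//; last exact: measurable_funTS.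
  apply: (mass_cvg q^-1) => //.
  - move=> m n mn; apply/subsetPset => t; rewrite /= !in_itv/= !andbT => qt.
    have t0 : 0 < t.
      rewrite -(pmulr_rgt0 _ (_ : 0 < q^-1 ^+ m)) ?exprn_gt0 ?invr_gt0//.
      exact: lt_trans qt.
    apply: lt_le_trans qt _; rewrite ler_pM2r// ler_weXn2l//.
    by rewrite invf_ge1// ltW.
  - apply/seteqP; split => x /=.
      move=> [n _] /=; rewrite in_itv/= andbT => xn; split => // xc.
      by move: xn; rewrite /dist xc subrr normr0 mulr0 ltr10.
    move=> [_ /eqP xc]; have dx : 0 < dist x by rewrite normr_gt0 subr_eq0.
    have [n qn] := exists_expr_lt q (dist x) q01 dx.
    exists n => //=; rewrite in_itv/= andbT exprVn ltr_pdivlMl ?exprn_gt0//.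
    by rewrite mulr1.
have : (mass `]-oo, 1%R]%classic + mass `]1%R, +oo[%classic = \int[leb]_x h x)%E.
  rewrite /mass -ge0_integral_setU//.
  - congr (integral _ _ _); apply/seteqP; split => // x _ /=.
    rewrite !in_itv/= andbT; have [|] := leP (dist x) 1; by [left|right].
  - exact: (mpreim `]-oo, 1]%classic).
  - exact: (mpreim `]1, +oo[%classic).
  - exact: measurable_funTS.
  - apply/disj_setPS => x [] /=; rewrite !in_itv/= andbT => /le_lt_trans/[apply].
    by rewrite ltxx.
rewrite inner outer.
have : (0 <= \int[leb]_x h x)%E by exact: integral_ge0.
move: (integral _ _ _) hoo => [r| |]//= _.
by rewrite lee_fin -EFinD => r0 [rr]; congr EFin; lra.
Qed.

End DilationInvariantDensity.

(** An overlap of 1 makes the defect of [overlap_defect] vanish, so F^2 is an invariant density of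
    total mass 1. Assuming [xi.2 != 1] sets aside the identity, whose overlap is 1, and the
    translations, which fix no point. *)
Lemma overlap_neq1 {R : realType} (F : R -> R) (xi : plane R) :
  0 < xi.2 -> xi.2 != 1 -> measurable_fun setT F -> (forall x, 0 <= F x) ->
  (\int[lebesgue_measure]_x (F x ^+ 2)%:E = 1)%E -> overlap F xi <> 1%E.
Proof.
move=> a0 a1 mF F0 F1 B1.
have := overlap_defect F xi a0 mF F0 F1; rewrite B1 mule1.
have mG := measurable_dilate xi F mF.
have mFG : measurable_fun setT (fun x => ((F x - dilate xi F x) ^+ 2)%:E).
  by apply/measurable_EFinP; apply: measurable_funX; exact: measurable_funB.
set J := (\int[_]_x _)%E => E.
(* From 2 + J = 2, J is finite and hence 0. *)
have J0 : J = 0%E.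
  by move: E; case: J => //= r [E]; congr EFin; lra.
have : (\int[lebesgue_measure]_x `|((F x - dilate xi F x) ^+ 2)%:E| = 0)%E.
  by rewrite -[RHS]J0; apply: eq_integral => x _; rewrite gee0_abs// lee_fin sqr_ge0.
move/(ae_eq_integral_abs lebesgue_measure measurableT mFG) => aeFG.
pose h x : \bar R := (F x ^+ 2)%:E.
suff : (\int[lebesgue_measure]_x h x = 0)%E by rewrite F1 => -[/eqP]; rewrite oner_eq0.
apply: (dilation_invariant_density_eq0 xi.2 xi.1 h a0 a1).
- by apply/measurable_EFinP; exact: measurable_funX.
- by move=> x; rewrite lee_fin sqr_ge0.
- apply: filterS aeFG => x /= /(_ I) [] /eqP; rewrite sqrf_eq0 subr_eq0 => /eqP FE _.
  by rewrite /h FE /dilate exprMn sqr_powR_half// EFinM.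
- by rewrite F1 ltry.
Qed.

(** * Slowly varying profiles and the limit of their overlaps *)

Lemma cvg_powR_at1 {R : realType} (u : nat -> R) (p : R) :
  u n @[n --> \oo] --> (1 : R) -> u n `^ p @[n --> \oo] --> (1 : R).
Proof.
move=> u1; have lnu : ln (u n) @[n --> \oo] --> ln 1.
  exact: (cvg_comp _ _ u1 (continuous_ln ltr01)).
have : expR (p * ln (u n)) @[n --> \oo] --> expR (p * ln 1).
  apply: continuous_cvg; first exact: continuous_expR.
  by apply: cvgM lnu; exact: cvg_cst.
(* [powR] is given by [expR (p * ln _)] away from 0, and [u n] is positive once it is within 1 of
   its limit. *)
rewrite ln1 mulr0 expR0; apply: cvg_trans; apply: near_eq_cvg.
have /cvgrPdist_lt/(_ 1 ltr01) := u1.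
apply: filterS => n /=; rewrite ltr_norml => /andP[_ u0].
by rewrite /powR gt_eqF//; lra.
Qed.

Section Extremizers.
Context {R : realType}.
Local Notation leb := (@lebesgue_measure R).

Lemma integral_shift_inv (c l u : R) : l < u -> 0 < l + c ->
  (\int[leb]_(x in `[l, u]) ((x + c)^-1)%:E = (ln (u + c) - ln (l + c))%:E)%E.
Proof.
move=> lu lc.
have pos x : l <= x -> 0 < x + c by move=> ?; lra.
have dln x : l <= x -> is_derive x 1 (fun y => ln (y + c)) (x + c)^-1.
  move=> lx; have dl := is_derive1_ln (pos x lx).
  have ds : is_derive x 1 (fun y : R => y + c) 1.
    exact: is_derive_shift.
  by have := is_derive1_comp (f := @ln R) (g := fun y => y + c) dl ds; rewrite mulr1.
have cln x : l <= x -> {for x, continuous (fun y => ln (y + c))}.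
  move=> lx; apply: differentiable_continuous; apply/derivable1_diffP.
  by have [] := dln x lx.
rewrite (continuous_FTC2 (F := fun x => ln (x + c)))//.
- apply: continuous_in_subspaceT => x; rewrite inE /= in_itv/= => /andP[lx _].
  apply: cvgV; first by rewrite gt_eqF// pos.
  apply: cvgD => //; exact: cvg_cst.
- split.
  + by move=> x; rewrite in_itv/= => /andP[/ltW lx _]; have [] := dln x lx.
  + by apply: cvg_at_right_filter; exact: cln.
  + by apply: cvg_at_left_filter; apply: cln; exact: ltW.
- move=> x; rewrite in_itv/= => /andP[/ltW lx _].
  by have [_] := dln x lx; rewrite derive1E.
Qed.

(** The square is the dilation-invariant density 1/x cut off to [1, e^s], normalized by its integral
    s. A dilation changes it only near the cutoffs, a vanishing share of the mass as s grows. *)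
Definition slow_profile (s : R) (x : R) : R :=
  (s * x) `^ (- 2^-1) * \1_(`[1, expR s]%classic) x.

Lemma slow_profile_ge0 s x : 0 <= slow_profile s x.
Proof. by rewrite mulr_ge0 ?powR_ge0. Qed.

Lemma measurable_slow_profile s : measurable_fun setT (slow_profile s).
Proof.
apply: measurable_funM; last exact: measurable_indic.
by apply: (measurableT_comp (measurable_powR _)); exact: measurable_funM.
Qed.

Lemma integral_sqr_slow_profile s : 0 < s ->
  (\int[leb]_x (slow_profile s x ^+ 2)%:E = 1)%E.
Proof.
move=> s0; transitivity (\int[leb]_(x in `[1%R, expR s]) (s^-1%:E * ((x + 0)^-1)%:E))%E.
  rewrite [RHS]integral_mkcond; apply: eq_integral => x _.
  rewrite /slow_profile patchE indicE; case: ifPn => [|_]; last first.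
    by rewrite mulr0 expr0n.
  rewrite inE /= in_itv/= => /andP[x1 _].
  by rewrite mulr1 sqr_powR_half ?invfM ?EFinM ?addr0// mulr_gt0//; lra.
have e1 : 1 < expR s by rewrite -expR0 ltr_expR.
rewrite ge0_integralZl//=; last 3 first.
- apply/measurable_EFinP; apply: measurable_funTS.
  apply: (measurableT_comp measurable_fun_inv); exact: measurable_funD.
- by move=> x; rewrite in_itv/= => /andP[x1 _]; rewrite lee_fin invr_ge0; lra.
- by rewrite lee_fin invr_ge0 ltW.
rewrite integral_shift_inv ?addr0// expRK ln1 subr0 -EFinM mulVf// gt_eqF//.
Qed.

(** Where both profiles live, their product is 1 / (s sqrt(x (x - b))), which is at least 1 / (s (x
    + |b|)). Integrating over [L, U] gives a difference of logarithms, of which U contributes at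
    least s + ln M. *)
Lemma overlap_slow_profile_ge (s : R) (xi : plane R) : 0 < s -> 0 < xi.2 ->
  ((1 - (ln (Num.max 1 (xi.2 + xi.1) + `|xi.1|) - ln (Num.min 1 xi.2)) / s)%:E
   <= overlap (slow_profile s) xi)%E.
Proof.
case: xi => b a /= s0 a0; set L := Num.max 1 (a + b); set M := Num.min 1 a.
(* On [L, U] both x and (x - b) / a lie in [1, e^s]. *)
pose U := Num.min (expR s) (a * expR s + b).
have e0 := expR_gt0 s.
have L1 : 1 <= L by rewrite le_max lexx.
have Lab : a + b <= L by rewrite le_max lexx orbT.
have M0 : 0 < M by rewrite lt_min ltr01.
have M1 : M <= 1 by rewrite ge_min lexx.
have Ma : M <= a by rewrite ge_min lexx orbT.
have Nb : 0 <= `|b| := normr_ge0 b.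
have bN : b <= `|b| := ler_norm b.
have Nbb : - `|b| <= b by rewrite lerNl -normrN ler_norm.
have MU : M * expR s <= U + `|b|.
  rewrite /U minEle; case: ifP => _.
    by rewrite -[leLHS]addr0 lerD// ger_pMl.
  have : M * expR s <= a * expR s by rewrite ler_pM2r.
  by move=> ?; lra.
have lnU : s + ln M <= ln (U + `|b|).
  rewrite -{1}(expRK s) addrC -lnM ?posrE// ler_ln ?posrE// ?mulr_gt0//.
  by apply: lt_le_trans MU; rewrite mulr_gt0.
(* If U <= L, the claimed lower bound is at most 0 and holds trivially. *)
have [LU|UL] := ltP L U; last first.
  apply: le_trans (overlap_ge0 _ _ (slow_profile_ge0 s)).
  rewrite lee_fin subr_le0 ler_pdivlMr// mul1r.
  have : ln (U + `|b|) <= ln (L + `|b|).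
    rewrite ler_ln ?posrE ?lerD2r//; last lra.
    by apply: lt_le_trans MU; rewrite mulr_gt0.
  by move=> ?; lra.
have mi : measurable_fun `[L, U] (fun x => ((x + `|b|)^-1)%:E).
  apply/measurable_EFinP; apply: measurable_funTS.
  by apply: (measurableT_comp measurable_fun_inv); exact: measurable_funD.
apply: (@le_trans _ _ (\int[leb]_(x in `[L, U]) (s^-1%:E * ((x + `|b|)^-1)%:E))%E).
  rewrite ge0_integralZl//=; last 2 first.
  - by move=> x; rewrite in_itv/= => /andP[Lx _]; rewrite lee_fin invr_ge0; lra.
  - by rewrite lee_fin invr_ge0 ltW.
  rewrite integral_shift_inv//; last by lra.
  rewrite -EFinM lee_fin -(ler_pM2l s0) mulrA divff ?gt_eqF// mul1r.
  rewrite mulrBr mulr1 mulrCA divff ?gt_eqF// mulr1; lra.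
rewrite integral_mkcond; apply: ge0_le_integral_nonmeasurable => x _.
  rewrite patchE; case: ifPn => //; rewrite inE /= in_itv/= => /andP[Lx _].
  by rewrite -EFinM lee_fin mulr_ge0// invr_ge0; lra.
rewrite patchE; case: ifPn => [|_]; last first.
  by rewrite lee_fin mulr_ge0 ?dilate_ge0 ?slow_profile_ge0// => ?; exact: slow_profile_ge0.
rewrite inE /= in_itv/= /U le_min => /and3P[Lx xe xae].
have y1 : 1 <= (x - b) / a by rewrite ler_pdivlMr//; lra.
have ye : (x - b) / a <= expR s by rewrite ler_pdivrMr//; lra.
rewrite -EFinM lee_fin /dilate /slow_profile /= !indicE.
rewrite !mem_set /= ?in_itv/= ?y1 ?ye ?xe//; last by lra.
have x0 : 0 < x by lra.
have xb0 : 0 < x - b by lra.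
have sy0 : 0 < s * ((x - b) / a) by rewrite mulr_gt0//; lra.
rewrite !mulr1 -(powRM _ (ltW a0) (ltW sy0)).
rewrite -powRM; [|exact/ltW/mulr_gt0..].
(* The normalizing factor of the dilation cancels the [a] in the dilated argument. *)
rewrite (_ : _ * (a * _) = (s * s) * (x * (x - b))); last first.
  by field; rewrite gt_eqF.
rewrite powRN powR12_sqrt; last by rewrite !mulr_ge0//; lra.
rewrite -invfM lef_pV2 ?posrE ?sqrtr_gt0 ?mulr_gt0//; [|lra..].
rewrite -[leRHS]ger0_norm; last by rewrite mulr_ge0//; lra.
rewrite -sqrtr_sqr ler_wsqrtr// expr2 [leRHS]mulrACA ler_pM2l ?mulr_gt0//.
by rewrite ler_pM//; lra.
Qed.

End Extremizers.

(** * Upper bound, its sharpness, and non-attainment *)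

Section AffineBounds.
Context {R : realType}.
Implicit Types (p : R) (Omega : set (plane R)) (F : R -> R) (f : R -> R[i]).

Lemma poweRK (x : \bar R) p : (0 <= x)%E -> 0 < p -> ((x `^ p) `^ p^-1 = x)%E.
Proof. by move=> x0 p0; rewrite -poweRrM divff ?gt_eqF// poweRe1. Qed.

Lemma poweRVK (x : \bar R) p : (0 <= x)%E -> 0 < p -> ((x `^ p^-1) `^ p = x)%E.
Proof. by move=> x0 p0; rewrite -poweRrM mulVf ?gt_eqF// poweRe1. Qed.

Lemma le_poweR (x y : \bar R) p : (0 <= x)%E -> (x <= y)%E -> 0 < p ->
  (x `^ p <= y `^ p)%E.
Proof.
move=> x0 xy p0; apply: gt0_ler_poweR => //; first exact: ltW.
  by rewrite in_itv/= x0 leey.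
by rewrite in_itv/= leey andbT (le_trans x0).
Qed.

Lemma powR_le1 (x : R) p : 0 < p -> 0 <= x -> x <= 1 -> x `^ p <= 1.
Proof.
move=> p0 x0 x1; rewrite [leRHS](_ : 1 = 1 `^ p); last by rewrite powR1.
by apply: ge0_ler_powR; rewrite ?nnegrE ?(ltW p0).
Qed.

Lemma LpOn_norm_ge0 p Omega (A : plane R -> R[i]) : (0 <= LpOn_norm p Omega A)%E.
Proof. exact: Lnorm_ge0. Qed.

Lemma fine_overlap_itv F xi : 0 < xi.2 -> measurable_fun setT F ->
  (forall x, 0 <= F x) -> (\int[lebesgue_measure]_x (F x ^+ 2)%:E = 1)%E ->
  [/\ overlap F xi = (fine (overlap F xi))%:E, 0 <= fine (overlap F xi)
    & fine (overlap F xi) <= 1].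
Proof.
move=> a0 mF F0 F1; have o0 := overlap_ge0 F xi F0.
have o1 := overlap_le1 F xi a0 mF F0 F1.
have ofin : overlap F xi \is a fin_num.
  by rewrite ge0_fin_numE// (le_lt_trans o1)// ltry.
by split; [rewrite fineK|exact: fine_ge0|rewrite -lee_fin fineK].
Qed.

Lemma measurable_fine_overlap_powR p F Omega :
  measurable_fun setT F -> (forall x, 0 <= F x) -> measurable Omega ->
  measurable_fun Omega (fun xi => ((fine (overlap F xi)) `^ p)%:E).
Proof.
move=> mF F0 mO; apply/measurable_EFinP; apply: measurable_funTS.
apply: (measurableT_comp (measurable_powR _)).
exact: (measurableT_comp (fine_measurable measurableT) (measurable_overlap F mF F0)).
Qed.

(** Compare p-th powers: the modulus of the ambiguity transform is at most 1 on [Omega]. *)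
Lemma LpOn_norm_ambiguity_le p Omega f : 0 < p -> measurable Omega ->
  Omega `<=` @Xi_aff R -> L2_unit_sphere f ->
  (LpOn_norm p Omega (ambiguity f) <= mu_aff Omega `^ p^-1)%E.
Proof.
move=> p0 mO OX Sf; rewrite -[leLHS](poweRK _ p (LpOn_norm_ge0 _ _ _) p0).
apply: le_poweR; rewrite ?poweR_ge0 ?invr_gt0//.
rewrite poweR_LpOn_norm// -[leRHS]mul1e -(integral_cst (@mu_aff R) mO 1%E).
apply: ge0_le_integral_nonmeasurable => xi Oxi; rewrite lee_fin ?powR_ge0//.
have a0 : 0 < xi.2 by exact: OX.
have A1 : cmodulus (ambiguity f xi) <= 1.
  rewrite -lee_fin; apply: le_trans (ambiguity_le_overlap f xi Sf a0) _.
  have [Lf f1] := Sf; apply: overlap_le1 => //; first exact: measurable_cmodulus_L2.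
    by move=> x; exact: cmodulus_ge0.
  exact: integral_sqr_cmodulus.
by apply: powR_le1 => //; exact: cmodulus_ge0.
Qed.

(** Test [S] on the profiles with s = n + 1. Their overlaps tend to 1 pointwise on [Omega],
    dominated by 1, which is integrable there since the measure is finite. *)
Lemma mu_aff_le_sup p Omega (S : \bar R) : 0 < p -> measurable Omega ->
  Omega `<=` @Xi_aff R -> (mu_aff Omega < +oo)%E ->
  (forall f, L2_unit_sphere f -> (LpOn_norm p Omega (ambiguity f) <= S)%E) ->
  (mu_aff Omega `^ p^-1 <= S)%E.
Proof.
move=> p0 mO OX Ooo HS.
have prof0 n x := slow_profile_ge0 (n.+1%:R : R) x.
have mprof n := measurable_slow_profile (n.+1%:R : R).
have prof1 n : (\int[lebesgue_measure]_x (slow_profile (n.+1%:R : R) x ^+ 2)%:E = 1)%E.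
  by apply: integral_sqr_slow_profile; rewrite ltr0n.
(* Nonnegativity of [S] is what allows recovering it from its p-th power; one unit vector suffices
   to see it. *)
have S0 : (0 <= S)%E.
  have S1 := real_L2_unit_sphere _ (mprof 0%N) (prof0 0%N) (prof1 0%N).
  exact: le_trans (LpOn_norm_ge0 p Omega _) (HS _ S1).
rewrite -(poweRK S p S0 p0); apply: le_poweR; rewrite ?invr_gt0 ?measure_ge0//.
pose v n xi : \bar R := ((fine (overlap (slow_profile (n.+1%:R : R)) xi)) `^ p)%:E.
have ov n xi : Omega xi -> _ := fun Oxi =>
  fine_overlap_itv _ xi (OX _ Oxi) (mprof n) (prof0 n) (prof1 n).
have : (\int[@mu_aff R]_(xi in Omega) v n xi)%E @[n --> \oo] -->
       (\int[@mu_aff R]_(xi in Omega) (cst 1 xi))%E.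
  apply: (dominated_cvg mO (g := cst 1%E)) => //.
  - by move=> n; exact: measurable_fine_overlap_powR.
  - move=> xi Oxi; apply: cvg_EFin; first exact: nearW.
    apply: cvg_powR_at1; have a0 := OX _ Oxi.
    (* [K] depends on [xi] but not on [n], so the overlap is squeezed between 1 - K / (n + 1) and
       1. *)
    pose K : R := ln (Num.max 1 (xi.2 + xi.1) + `|xi.1|) - ln (Num.min 1 xi.2).
    apply: (squeeze_cvgr (f := fun n => 1 - K * n.+1%:R^-1) (h := fun=> 1)).
    + apply: nearW => n; have [oE o0 o1] := ov n xi Oxi.
      rewrite o1 andbT -lee_fin -oE.
      by apply: overlap_slow_profile_ge => //; rewrite ltr0n.
    + rewrite -[X in _ --> X]subr0 -[X in _ --> _ - X](mulr0 K).
      apply: cvgB; first exact: cvg_cst.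
      by apply: cvgM; [exact: cvg_cst|exact: cvg_harmonic].
    + exact: cvg_cst.
  - apply/integrableP; split; first exact: measurable_cst.
    by under eq_integral do rewrite /= normr1; rewrite integral_cst// mul1e.
  - move=> n xi Oxi; have [_ o0 o1] := ov n xi Oxi.
    by rewrite /v gee0_abs ?lee_fin ?powR_ge0//; exact: powR_le1.
rewrite integral_cst// mul1e => /(cvge_le _); apply; apply: nearW => n.
have Sn := real_L2_unit_sphere _ (mprof n) (prof0 n) (prof1 n).
apply: le_trans _ (le_poweR _ _ _ (LpOn_norm_ge0 _ _ _) (HS _ Sn) p0).
rewrite poweR_LpOn_norm//.
apply: ge0_le_integral_nonmeasurable => xi Oxi; rewrite ?lee_fin ?powR_ge0//.
have [oE _ _] := ov n xi Oxi.
by rewrite -lee_fin /v -[X in fine X](cmodulus_ambiguity_real _ xi (OX _ Oxi)).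
Qed.

Lemma measurable_unit_dilations : measurable [set xi : plane R | xi.2 = 1].
Proof.
rewrite (_ : mkset _ = setT `*` [set 1]); first exact: measurableX.
by apply/seteqP; split => -[b a] /=; [|case].
Qed.

(** A line has zero area, and [mu_aff] has a density with respect to area. *)
Lemma mu_aff_unit_dilations : mu_aff [set xi : plane R | xi.2 = 1] = 0%E.
Proof.
have mLX := measurableI _ _ measurable_unit_dilations (@measurable_Xi_aff R).
apply: null_set_integral => //.
  by apply: measurable_haar_density => // xi [].
have mT1 : measurable (setT `*` [set 1] : set (plane R)) by exact: measurableX.
have sT1 : [set xi : plane R | xi.2 = 1] `&` @Xi_aff R `<=` setT `*` [set 1].
  by move=> [b a] [].
refine (subset_measure0 mLX mT1 sT1 _).
have T1E := product_measure1E (@lebesgue_measure R) (@lebesgue_measure R)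
  (@measurableT _ (measurableTypeR R)) (measurable_set1 (1 : R)).
have T10 : (@lebesgue_measure R setT * lebesgue_measure [set (1%R : R)] = 0)%E.
  by rewrite lebesgue_measure_set1 mule0.
exact: (etrans T1E T10).
Qed.

(** Equality would force the p-th power of the overlap, which is at most 1, to have integral
    [mu_aff Omega]; the overlap would then be 1 almost everywhere on [Omega]. By [overlap_neq1] this
    fails off the null line a = 1, so [Omega] would be null. *)
Lemma LpOn_norm_ambiguity_neq p Omega f : 0 < p -> measurable Omega ->
  Omega `<=` @Xi_aff R -> (0 < mu_aff Omega)%E -> (mu_aff Omega < +oo)%E ->
  L2_unit_sphere f ->
  LpOn_norm p Omega (ambiguity f) <> (mu_aff Omega `^ p^-1)%E.
Proof.
move=> p0 mO OX Ogt0 Ooo Sf E.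
have [Lf f1] := Sf; pose F := cmodulus (R:=R) \o f.
have mF : measurable_fun setT F by exact: measurable_cmodulus_L2.
have F0 x : 0 <= F x by exact: cmodulus_ge0.
have F1 : (\int[lebesgue_measure]_x (F x ^+ 2)%:E = 1)%E.
  exact: integral_sqr_cmodulus.
pose B xi := fine (overlap F xi).
have ov xi : Omega xi -> _ := fun Oxi => fine_overlap_itv F xi (OX _ Oxi) mF F0 F1.
have Bp1 xi : Omega xi -> (B xi) `^ p <= 1.
  by move=> /ov [_ o0 o1]; exact: powR_le1.
have mB := measurable_fine_overlap_powR p F Omega mF F0 mO.
(* Passing from the ambiguity transform to its majorant [B] keeps the lower bound and supplies a
   function known to be measurable. *)
have leB : (mu_aff Omega <= \int[@mu_aff R]_(xi in Omega) ((B xi) `^ p)%:E)%E.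
  rewrite -[leLHS](poweRVK _ p)// -E poweR_LpOn_norm//.
  apply: ge0_le_integral_nonmeasurable => xi Oxi; rewrite lee_fin ?powR_ge0//.
  have [oE o0 _] := ov xi Oxi.
  apply: ge0_ler_powR; rewrite ?nnegrE ?(ltW p0) ?cmodulus_ge0//.
  by rewrite -lee_fin -oE; exact: ambiguity_le_overlap (OX _ Oxi).
have mD : measurable_fun Omega (fun xi => (1 - (B xi) `^ p)%:E).
  by apply/measurable_EFinP; apply: measurable_funB => //; exact/measurable_EFinP.
(* Finiteness of [mu_aff Omega] permits cancelling it from the sum of the two integrals. *)
have D0 : (\int[@mu_aff R]_(xi in Omega) (1 - (B xi) `^ p)%:E = 0)%E.
  have : (\int[@mu_aff R]_(xi in Omega) (1 - (B xi) `^ p)%:E +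
     \int[@mu_aff R]_(xi in Omega) ((B xi) `^ p)%:E = mu_aff Omega)%E.
    rewrite -ge0_integralD//.
    - under eq_integral => xi _ do rewrite -EFinD subrK.
      by rewrite integral_cst// mul1e.
    - by move=> xi Oxi; rewrite lee_fin subr_ge0 Bp1.
    - by move=> xi Oxi; rewrite lee_fin powR_ge0.
  have : (0 <= \int[@mu_aff R]_(xi in Omega) (1 - (B xi) `^ p)%:E)%E.
    by apply: integral_ge0 => xi Oxi; rewrite lee_fin subr_ge0 Bp1.
  move: leB Ooo Ogt0; move: (mu_aff Omega) => m.
  move: (\int[_]_(_ in _) (1 - _)%:E)%E (\int[_]_(_ in _) _)%E.
  move: m => [m| |] [d| |] [e| |]//=.
  by rewrite !lee_fin -EFinD => me _ _ d0 [dem]; congr EFin; lra.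
have aeB : {ae @mu_aff R, forall xi, Omega xi -> (1 - (B xi) `^ p)%:E = 0%E}.
  apply/(ae_eq_integral_abs (@mu_aff R) mO mD).
  rewrite -[RHS]D0; apply: eq_integral => xi; rewrite inE => Oxi.
  by rewrite gee0_abs// lee_fin subr_ge0 Bp1.
have aeL : {ae @mu_aff R, forall xi, xi.2 <> 1}.
  exists [set xi : plane R | xi.2 = 1]; split.
  - exact: measurable_unit_dilations.
  - exact: mu_aff_unit_dilations.
  - by move=> xi /= /contrapT.
have aeO : {ae @mu_aff R, forall xi, ~ Omega xi}.
  apply: filterS2 aeB aeL => xi /= HB a1 Oxi.
  have [oE o0 o1] := ov xi Oxi.
  have /eqP/(overlap_neq1 F xi (OX _ Oxi)) := a1; apply => //.
  rewrite oE; congr EFin; have [/eqP] := HB Oxi.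
  rewrite subr_eq0 => /eqP Bp.
  have : (B xi `^ p) `^ p^-1 = 1 by rewrite -Bp powR1.
  by rewrite -powRrM divff ?gt_eqF// powRr1.
have : mu_aff Omega = 0%E.
  apply/negligibleP => //; apply: negligibleS aeO.
  by move=> xi /=; rewrite notK.
by move=> O0; rewrite O0 ltxx in Ogt0.
Qed.

End AffineBounds.

Theorem propositionB3 (R : realType) (p : R) (Omega : set (plane R)) :
  1 <= p ->
  measurable Omega ->
  Omega `<=` @Xi_aff R ->
  (0 < mu_aff Omega)%E ->
  (mu_aff Omega < +oo)%E ->
  ereal_sup [set LpOn_norm p Omega (ambiguity f) | f in @L2_unit_sphere R]
    = (mu_aff Omega `^ p^-1)%E
  /\ ~ (exists2 f : R -> R[i], L2_unit_sphere f &
         LpOn_norm p Omega (ambiguity f) =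
         ereal_sup [set LpOn_norm p Omega (ambiguity g)
                   | g in @L2_unit_sphere R]).
Proof.
move=> p1 mO OX Ogt0 Ooo; have p0 : 0 < p by exact: lt_le_trans p1.
have supE : ereal_sup [set LpOn_norm p Omega (ambiguity f) | f in @L2_unit_sphere R]
    = (mu_aff Omega `^ p^-1)%E.
  apply/eqP; rewrite eq_le; apply/andP; split.
    by apply: ge_ereal_sup => _ [f Sf <-]; exact: LpOn_norm_ambiguity_le.
  apply: mu_aff_le_sup => // f Sf.
  by apply: ereal_sup_ubound; exists f.
by split=> // -[f Sf]; rewrite supE; exact: LpOn_norm_ambiguity_neq.
Qed.
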